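(* Let $n\geq 3$ be an integer. The set $G=\{g_{m,l}\mid m,l\in\mathbb{N}_0,\ m+l\leq n+1\}$ is the reduced Gröbner basis for the ideal $I_{3,n}=(\overline{w}_{n+1},\overline{w}_{n+2},\overline{w}_{n+3})$ in $\mathbb{Z}_2[w_1,w_2,w_3]$ with respect to the grlex ordering $\preceq$ with $w_1>w_2>w_3$.
   Context: $\mathbb{N}_0$ is the set of nonnegative integers. Binomial coefficients $\binom{x}{b}$ with $x\in\mathbb{Z}$ (possibly negative) and $b\in\mathbb{Z}$ are $\binom{x}{b}=\frac{x(x-1)\cdots(x-b+1)}{b!}$ for $b\geq 0$ and $\binom{x}{b}=0$ for $b<0$; as coefficients of polynomials they are reduced mod $2$. For $r\geq 1$, $\overline{w}_r=\sum_{a+2b+3c=r}\binom{a+b+c}{a}\binom{b+c}{b}w_1^aw_2^bw_3^c\in\mathbb{Z}_2[w_1,w_2,w_3]$, the sum over $a,b,c\in\mathbb{N}_0$. For the fixed $n$ and $m,l\in\mathbb{N}_0$, $$g_{m,l}:=\sum_{a+2b+3c=n+1+m+2l}\binom{a+b+c-m-l}{a}\binom{b+c-l}{b}w_1^aw_2^bw_3^c\in\mathbb{Z}_2[w_1,w_2,w_3],$$ the sum over $a,b,c\in\mathbb{N}_0$. The grlex ordering: $w_1^aw_2^bw_3^c\prec w_1^dw_2^ew_3^f$ iff $a+b+c<d+e+f$; or $a+b+c=d+e+f$ and $a<d$; or $a+b+c=d+e+f$, $a=d$ and $b<e$ (so the total degree used is the sum of the exponents). *)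

(* Defs.v *)
From HB Require Import structures.
From mathcomp Require Import all_boot all_order all_algebra.
From mathcomp Require Import finmap mpoly zify.

Set Implicit Arguments.
Unset Strict Implicit.
Unset Printing Implicit Defensive.

Import GRing.Theory.

Local Open Scope ring_scope.

Definition ideal_gen (R : comNzRingType) (S : R -> Prop) (p : R) : Prop :=
  exists s : seq (R * R),
    (forall x, x \in s -> S x.2) /\ p = \sum_(x <- s) x.1 * x.2.

(* The order on monomials underlying [mlead] is the canonical one on
   ['X_{1..n}]: total degree first, then lexicographic with the variable of
   index 0 the largest; see [grlexE] below for n = 3. *)
Section Groebner.
Variables (K : fieldType) (n : nat).
Implicit Types (G : {fset {mpoly K[n]}}) (I : {mpoly K[n]} -> Prop).

Definition lead_term (p : {mpoly K[n]}) : {mpoly K[n]} :=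
  mleadc p *: 'X_[mlead p].

Definition lead_ideal (S : {mpoly K[n]} -> Prop) : {mpoly K[n]} -> Prop :=
  ideal_gen (fun q => exists p, [/\ S p, p != 0 & q = lead_term p]).

Definition is_groebner_basis I G : Prop :=
  (forall p, ideal_gen (fun q => q \in G) p <-> I p) /\
  (forall p, lead_ideal (fun q => q \in G) p <-> lead_ideal I p).

Definition is_reduced_groebner_basis I G : Prop :=
  [/\ is_groebner_basis I G,
      forall p, p \in G -> mleadc p = 1
    & forall p, p \in G -> forall m, m \in msupp p ->
        ~ lead_ideal (fun q => q \in (G `\ p)%fset) 'X_[m]].

End Groebner.

(* The division in [int] is exact. *)
Definition binz (x : int) (b : nat) : int :=
  ((\prod_(i < b) (x - i%:Z)) %/ (b`!)%:Z)%Z.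

Definition Z2w := {mpoly 'F_2[3]}.

Definition mon3 (a b c : nat) : 'X_{1..3} := [multinom [tuple a; b; c]].

Lemma grlexE (a b c d e f : nat) :
  (mon3 a b c < mon3 d e f)%O =
  [|| (a + b + c < d + e + f)%N,
      (a + b + c == d + e + f)%N && (a < d)%N
    | [&& (a + b + c == d + e + f)%N, a == d & (b < e)%N]].
Proof.
have deg x y z : mdeg (mon3 x y z) = (x + y + z)%N.
  by rewrite mdegE !big_ord_recr big_ord0 !multinomE !(tnth_nth 0%N).
have val3 x y z : mon3 x y z = [:: x; y; z] :> seq nat by [].
rewrite ltEmnm !deg !val3 !ltxi_cons.
rewrite ltxi0s !leEnat.
case: (ltngtP (a + b + c)%N) => //= eq_deg.
case: (ltngtP a) => //= eq_a; case: (ltngtP b) => //= eq_b.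
have -> : c = f by lia.
by rewrite leqnn.
Qed.

(* All a, b, c with a + 2 b + 3 c = N are at most N. *)
Definition weighted_sum (N : nat) (coef : nat -> nat -> nat -> int) : Z2w :=
  \sum_(a < N.+1) \sum_(b < N.+1) \sum_(c < N.+1 | (a + 2 * b + 3 * c == N)%N)
    (coef a b c)%:~R *: 'X_[mon3 a b c].

Definition wbar (r : nat) : Z2w :=
  weighted_sum r (fun a b c => ('C(a + b + c, a) * 'C(b + c, b))%N%:Z).

Definition I3 (n : nat) : Z2w -> Prop :=
  ideal_gen (fun q => q \in [:: wbar n.+1; wbar n.+2; wbar n.+3]).

Definition g (n m l : nat) : Z2w :=
  weighted_sum (n + 1 + m + 2 * l) (fun a b c =>
    binz ((a + b + c)%N%:Z - m%:Z - l%:Z) a * binz ((b + c)%N%:Z - l%:Z) b).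

Definition G (n : nat) : {fset Z2w} :=
  [fset g n m l | m in iota 0 n.+2, l in iota 0 n.+2 & (m + l <= n.+1)%N]%fset.

Lemma in_G (n : nat) (p : Z2w) :
  reflect (exists m l, (m + l <= n + 1)%N /\ p = g n m l) (p \in G n).
Proof.
apply: (iffP idP) => [/imfset2P[m _ [l]]|[m [l [le_ml ->]]]].
  by rewrite !inE addn1 => /andP[_ le_ml] ->; exists m, l.
apply/imfset2P; exists m; first by change (m \in iota 0 n.+2); rewrite mem_iota; lia.
by exists l; rewrite // !inE mem_iota; lia.
Qed.

(* Main.v *)
Require Import Defs.
From mathcomp Require Import all_boot all_order all_algebra.
From mathcomp Require Import finmap mpoly.
From mathcomp Require Import zify.

Set Implicit Arguments.
Unset Strict Implicit.
Unset Printing Implicit Defensive.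

Import Order.TTheory GRing.Theory Num.Theory.

Local Open Scope ring_scope.

(** Let [H d x y] ([gpoly] below) be the sum of
      [binz (a+b+c-x) a * binz (b+c-y) b * w1^a w2^b w3^c]
    over [a + 2b + 3c = d + x + y], so that [g n m l = H (n+1) (m+l) l] and
    [wbar r = H r 0 0].  Pascal's rule in each binomial and a shift of [c] give
    three recurrences modulo 2 ([gpolyS_w1], [gpolyS_w2], [gpolyS_w3]):
      [H (d+1) x y = w1 (H d x y) + H d (x+1) y],
      [H (d+1) x y = w2 (H d (x-1) y) + H d x (y+1)],
      [H (d+1) (x+1) (y+1) = w3 (H d x y)],
    the last one for [0 <= y <= x] and [d > -3].

    For [0 <= y <= x <= d] the polynomial [H d x y] is the monomial
    [w1^(d-x) w2^(x-y) w3^y] plus terms of smaller total degree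
    ([mcoeff_stdpoly]).  Hence there is exactly one such polynomial for each
    monomial [m]; it is called [stdpoly m].  The set [G n] consists of the
    [stdpoly m] with [m] of degree [n+1], so its leading monomials are all the
    monomials of degree [n+1].

    The recurrences show that [G n] and the three dual classes generate the same
    ideal ([I3_gpoly], [ideal_gen_G_I3]).  It remains to see that a nonzero
    element of this ideal has a leading monomial of degree at least [n+1].  Let
    [S] be the span of the [stdpoly m] with [m] of degree at least [n+1]; the
    leading monomials being distinct, nonzero elements of [S] have this property
    ([inspan_lead]).  By the recurrences, a product of [stdpoly m] by a variable
    is a sum of polynomials [H d x y], and all of them are standard except
    possibly for some with [x = d+1].  Those reduce, by the third recurrence, to
    [H e (e+1) 0], which is a combination of the standard polynomials
    [H e (e-j) (j+1)] with binomial coefficients ([overflowE]).  So [S] is an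
    ideal ([inspanM]), it contains [G n], and [G n] is a Groebner basis.  It is
    reduced because the non-leading terms of its elements have degree at most
    [n].

    Uniqueness of the reduced Groebner basis is the usual general fact
    ([reduced_groebner_unique]). *)

(** * Generated ideals *)

Section IdealGen.
Variable R : comNzRingType.
Implicit Types (S T : R -> Prop) (p q : R).

Lemma ideal_gen_mem S p : S p -> ideal_gen S p.
Proof.
move=> Sp; exists [:: (1, p)]; split; last by rewrite big_seq1 mul1r.
by move=> x; rewrite inE => /eqP->.
Qed.

Lemma ideal_gen0 S : ideal_gen S 0.
Proof. by exists [::]; split=> //; rewrite big_nil. Qed.

Lemma ideal_genD S p q :
  ideal_gen S p -> ideal_gen S q -> ideal_gen S (p + q).
Proof.
move=> [s [Ss ->]] [t [St ->]]; exists (s ++ t); split; last by rewrite big_cat.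
by move=> x; rewrite mem_cat => /orP[/Ss|/St].
Qed.

Lemma ideal_genM S p q : ideal_gen S q -> ideal_gen S (p * q).
Proof.
move=> [s [Ss ->]]; exists [seq (p * x.1, x.2) | x <- s]; split.
  by move=> x /mapP[y /Ss Sy ->].
by rewrite big_map big_distrr; apply: eq_bigr => x _; rewrite /= mulrA.
Qed.

Lemma ideal_genB S p q :
  ideal_gen S p -> ideal_gen S q -> ideal_gen S (p - q).
Proof.
by move=> Sp Sq; apply: ideal_genD => //; rewrite -mulN1r; apply: ideal_genM.
Qed.

Lemma ideal_gen_sub S T p :
  (forall q, S q -> ideal_gen T q) -> ideal_gen S p -> ideal_gen T p.
Proof.
move=> ST [s [Ss ->]]; rewrite big_seq.
apply: (big_ind (ideal_gen T)); first exact: ideal_gen0.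
  exact: ideal_genD.
by move=> x xs; apply/ideal_genM/ST/Ss.
Qed.

End IdealGen.

(** * Uniqueness of reduced Groebner bases *)

Section Uniqueness.
Variables (K : fieldType) (n : nat).
Implicit Types (S T : {mpoly K[n]} -> Prop) (p q : {mpoly K[n]}).
Implicit Types (A B : {fset {mpoly K[n]}}).

Lemma lead_ideal_mono S T :
  (forall p, S p -> T p) -> forall p, lead_ideal S p -> lead_ideal T p.
Proof.
move=> ST p; apply: ideal_gen_sub => q [r [Sr r0 ->]].
by apply: ideal_gen_mem; exists r; split=> //; apply: ST.
Qed.

(** A monomial lies in a monomial ideal only if a generator divides it. *)
Lemma mem_lead_idealX S m :
  lead_ideal S 'X_[m] -> exists2 p, S p & p != 0 /\ (mlead p <= m)%MM.
Proof.
move=> [s [Ss Xm]].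
have : 'X_[m]@_m != 0 :> K by rewrite mcoeffX eqxx oner_neq0.
rewrite Xm raddf_sum /= => nz.
have [x xs cx] : exists2 x, x \in s & (x.1 * x.2)@_m != 0.
  apply/hasP; apply: contraNT nz => /hasPn all0.
  by rewrite big_seq big1 // => x /all0; rewrite negbK => /eqP.
have [p [Sp p0 x2]] := Ss _ xs.
exists p => //; split=> //.
move: cx; rewrite x2 /lead_term -scalerAr mcoeffZ mulf_eq0 negb_or => /andP[_].
rewrite -mcoeff_msupp (perm_mem (msuppMX _ _)) => /mapP[k _ ->].
exact: lem_addr.
Qed.

Lemma lead_idealX S p m :
  S p -> p != 0 -> (mlead p <= m)%MM -> lead_ideal S 'X_[m].
Proof.
move=> Sp p0 le_pm.
have lc0 : mleadc p != 0 by rewrite mleadc_eq0.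
have -> : 'X_[m] = ((mleadc p)^-1 *: 'X_[m - mlead p]) * lead_term p.
  rewrite /lead_term -scalerAr -scalerAl scalerA divff // scale1r.
  by rewrite -mpolyXD submK.
by apply/ideal_genM/ideal_gen_mem; exists p.
Qed.

Lemma lepm_anti (m k : 'X_{1..n}) : (m <= k)%MM -> (k <= m)%MM -> m = k.
Proof.
move=> /mnm_lepP mk /mnm_lepP km; apply/mnmP => i.
by apply/eqP; rewrite eqn_leq mk km.
Qed.

Section Reduced.
Variables (I : {mpoly K[n]} -> Prop) (A : {fset {mpoly K[n]}}).
Hypothesis redA : is_reduced_groebner_basis I A.

Lemma reduced_neq0 p : p \in A -> p != 0.
Proof.
case: redA => _ lc _ /lc; apply: contra_eq_neq => ->.
by rewrite mleadc0 eq_sym oner_neq0.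
Qed.

Lemma reduced_sub p : p \in A -> I p.
Proof. by case: redA => [[genA _] _ _] Ap; apply/genA/ideal_gen_mem. Qed.

(** The leading monomials of a Groebner basis divide all those of the ideal. *)
Lemma reduced_lead_dvd p :
  I p -> p != 0 -> exists2 q, q \in A & (mlead q <= mlead p)%MM.
Proof.
case: redA => [[_ leadA] _ _] Ip p0.
have /leadA/mem_lead_idealX[q Aq [_ le_qp]] := lead_idealX Ip p0 (lepm_refl _).
by exists q.
Qed.

(** No monomial of an element of a reduced basis is divisible by the leading
    monomial of another element. *)
Lemma reduced_dvd_eq p q m :
  p \in A -> q \in A -> m \in msupp p -> (mlead q <= m)%MM -> q = p.
Proof.
case: redA => _ _ red Ap Aq mp le_qm; apply/eqP/negPn/negP => neq.
apply: (red p Ap m mp); apply: (@lead_idealX _ q) => //.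
  by rewrite in_fsetD1 neq.
exact: reduced_neq0.
Qed.

End Reduced.

(** The basis [B] has an element [q] with the same leading monomial as [p], and
    then [p = q]. *)
Lemma reduced_groebner_sub I A B :
    is_reduced_groebner_basis I A -> is_reduced_groebner_basis I B ->
  forall p, p \in A -> p \in B.
Proof.
move=> redA redB p Ap.
have p0 := reduced_neq0 redA Ap; have Ip := reduced_sub redA Ap.
have [q Bq le_qp] := reduced_lead_dvd redB Ip p0.
have q0 := reduced_neq0 redB Bq; have Iq := reduced_sub redB Bq.
have [r Ar le_rq] := reduced_lead_dvd redA Iq q0.
have rp := reduced_dvd_eq redA Ap Ar (mlead_supp p0) (lepm_trans le_rq le_qp).
move: le_rq; rewrite {r Ar}rp => le_pq.
have lead_eq := lepm_anti le_pq le_qp.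
(* Two elements with the same leading monomial are equal: the leading monomial
   of their difference would be a non-leading monomial of one of them. *)
have [/eqP|d0] := eqVneq (p - q) 0; first by rewrite subr_eq0 => /eqP->.
have Id : I (p - q).
  by case: redA => [[genA _] _ _]; apply/genA/ideal_genB; apply/genA.
have lead_d : (p - q)@_(mlead p) = 0.
  case: redA redB => _ lcA _ [_ lcB _].
  by rewrite mcoeffB lcA // lead_eq lcB // subrr.
have neq_lead : mlead (p - q) != mlead p.
  by apply: contraNneq d0 => e; rewrite -mleadc_eq0 e lead_d.
have := msuppB_le (mlead_supp d0); rewrite mem_cat => /orP[dp|dq].
- have [r Ar le_r] := reduced_lead_dvd redA Id d0.
  have rp := reduced_dvd_eq redA Ap Ar dp le_r.
  case/negP: neq_lead; apply/eqP/le_anti.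
  by rewrite msupp_le_mlead // -{1}rp lem_leo.
- have [r Br le_r] := reduced_lead_dvd redB Id d0.
  have rq := reduced_dvd_eq redB Bq Br dq le_r.
  case/negP: neq_lead; apply/eqP/le_anti.
  by rewrite lead_eq msupp_le_mlead // -{1}rq lem_leo.
Qed.

Lemma reduced_groebner_unique I A B :
    is_reduced_groebner_basis I A -> is_reduced_groebner_basis I B -> A = B.
Proof.
move=> redA redB; apply/fsetP => p.
apply/idP/idP; [exact: (reduced_groebner_sub redA redB)|].
exact: (reduced_groebner_sub redB redA).
Qed.

End Uniqueness.

(** * Binomial coefficients with an integer top *)

Section IntegerBinomial.
Implicit Types (x : int) (b k : nat).

Lemma prod_ffact k b : \prod_(i < b) (k%:Z - i%:Z) = (k ^_ b)%:Z.
Proof.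
elim: b => [|b IHb]; first by rewrite big_ord0 ffactn0.
rewrite big_ord_recr /= IHb ffactnSr PoszM.
have [/subzn -> //|lt_kb] := leqP b k.
by rewrite ffact_small // !mul0r.
Qed.

Lemma prod_ffactN k b :
  \prod_(i < b) (Negz k - i%:Z) = (-1) ^+ b * ((k + b) ^_ b)%:Z.
Proof.
elim: b => [|b IHb]; first by rewrite big_ord0 ffactn0 mulr1.
rewrite big_ord_recr /= IHb addnS ffactSS PoszM NegzE exprS; lia.
Qed.

(** The division in the definition of [binz] is exact. *)
Lemma binz_fact x b : binz x b * (b`!)%:Z = \prod_(i < b) (x - i%:Z).
Proof.
rewrite /binz divzK //; case: x => k.
  by rewrite prod_ffact -bin_ffact PoszM dvdz_mull.
by rewrite prod_ffactN -bin_ffact PoszM mulrA dvdz_mull.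
Qed.

Lemma fact_lreg b : injective (fun x => x * (b`!)%:Z).
Proof. by apply: mulIf; rewrite -lt0n fact_gt0. Qed.

Lemma binz0 x : binz x 0 = 1.
Proof. by apply: (@fact_lreg 0); rewrite binz_fact big_ord0. Qed.

Lemma binz_nat k b : binz k%:Z b = 'C(k, b)%:Z.
Proof.
by apply: (@fact_lreg b); rewrite /= binz_fact prod_ffact -bin_ffact PoszM.
Qed.

Lemma binz_small k b : (k < b)%N -> binz k%:Z b = 0.
Proof. by move=> lt_kb; rewrite binz_nat bin_small. Qed.

Lemma binz_pascal x b : binz (x + 1) b.+1 = binz x b.+1 + binz x b.
Proof.
apply: (@fact_lreg b.+1); rewrite /= mulrDl !binz_fact big_ord_recl.
rewrite [in RHS]big_ord_recr /= factS PoszM mulrCA binz_fact.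
set p := \prod_(i < b) (x - i%:Z).
have -> : \prod_(i < b) (x + 1 - (bump 0 i)%:Z) = p.
  by apply: eq_bigr => i _; rewrite /bump /=; lia.
by lia.
Qed.

End IntegerBinomial.

(** * The polynomials and their recurrences *)

Section Family.
Implicit Types (d x y : int) (a b c : nat) (p : Z2w).

Lemma mon3_eqE a b c a' b' c' :
  (mon3 a b c == mon3 a' b' c') = [&& a == a', b == b' & c == c'].
Proof.
apply/eqP/and3P => [e|[/eqP-> /eqP-> /eqP->] //].
by have /= [-> -> ->] : mon3 a b c = mon3 a' b' c' :> seq nat by rewrite e.
Qed.

Lemma mon3P (m : 'X_{1..3}) : exists a b c, m = mon3 a b c.
Proof.
exists (m ord0), (m (lift ord0 ord0)), (m ord_max); apply/mnmP => i.
rewrite multinomE (tnth_nth 0%N).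
by case: i => [[|[|[|//]]] lt_i] /=; congr (m _); apply: val_inj.
Qed.

Lemma mon3D a b c a' b' c' :
  (mon3 a b c + mon3 a' b' c')%MM = mon3 (a + a') (b + b') (c + c').
Proof.
apply/mnmP => i; rewrite ?mnmDE !multinomE !(tnth_nth 0%N).
by case: i => [[|[|[|//]]] lt_i].
Qed.

Lemma mon3_le a b c a' b' c' :
  (mon3 a b c <= mon3 a' b' c')%MM = [&& a <= a', b <= b' & c <= c']%N.
Proof.
apply/mnm_lepP/and3P => [le|[le1 le2 le3] i]; last first.
  by rewrite ?mnmDE !multinomE !(tnth_nth 0%N); case: i => [[|[|[|//]]] lt_i].
split; [move: (le ord0)|move: (le (lift ord0 ord0))|move: (le ord_max)];
  by rewrite ?mnmDE !multinomE !(tnth_nth 0%N).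
Qed.

Lemma mdeg_mon3 a b c : mdeg (mon3 a b c) = (a + b + c)%N.
Proof. by rewrite mdegE !big_ord_recr big_ord0 !multinomE !(tnth_nth 0%N). Qed.

Lemma mcoeff_weighted_sum N coef a b c :
  (weighted_sum N coef)@_(mon3 a b c) =
    if (a + 2 * b + 3 * c == N)%N then (coef a b c)%:~R else 0.
Proof.
rewrite /weighted_sum raddf_sum /=.
under eq_bigr do rewrite raddf_sum /=.
under eq_bigr do under eq_bigr do rewrite raddf_sum /=.
under eq_bigr do under eq_bigr do under eq_bigr do
  rewrite mcoeffZ mcoeffX mon3_eqE.
case: eqP => [eqN|neN]; last first.
  rewrite big1 // => i _; rewrite big1 // => j _; rewrite big1 // => k /eqP eN.
  case: and3P => [[/eqP ea /eqP eb /eqP ec]|_]; last by rewrite mulr0.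
  by case: neN; rewrite -ea -eb -ec.
have lta : (a < N.+1)%N by lia.
have ltb : (b < N.+1)%N by lia.
have ltc : (c < N.+1)%N by lia.
rewrite (bigD1 (Ordinal lta)) //= (bigD1 (Ordinal ltb)) //=.
rewrite (bigD1 (Ordinal ltc)) /=; last exact/eqP.
rewrite !eqxx mulr1 !big1 ?addr0 //.
- move=> i /negPf nei; rewrite big1 // => j _; rewrite big1 // => k _.
  by rewrite (_ : (i : nat) == a = false) ?mulr0 // -nei.
- move=> j /negPf nej; rewrite big1 // => k _.
  by rewrite (_ : (j : nat) == b = false) ?andbF ?mulr0 // -nej.
- move=> k /andP[_ /negPf nek].
  by rewrite (_ : (k : nat) == c = false) ?andbF ?mulr0 // -nek.
Qed.

(** The common generalization of the polynomials [g n m l] and [wbar r], indexed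
    by [x = m + l], [y = l] and the total degree [d] of the leading term.  The
    indices are integers, so that the recurrences hold without side conditions on
    subtractions; the sum is empty, hence zero, when the weight [d + x + y] is
    negative. *)
Definition gcoef x y a b c : int :=
  binz ((a + b + c)%N%:Z - x) a * binz ((b + c)%N%:Z - y) b.

Definition gpoly d x y : Z2w :=
  if 0 <= d + x + y then weighted_sum `|d + x + y| (gcoef x y) else 0.

Lemma mcoeff_gpoly d x y a b c :
  (gpoly d x y)@_(mon3 a b c) =
    if (a + 2 * b + 3 * c)%N%:Z == d + x + y then (gcoef x y a b c)%:~R else 0.
Proof.
rewrite /gpoly; case: ifP => N0; last first.
  rewrite mcoeff0; case: eqP => // e; lia.
rewrite mcoeff_weighted_sum; congr (if _ then _ else _); lia.
Qed.

Lemma gpolyN1 : gpoly (-1) 0 0 = 0.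
Proof. by rewrite /gpoly. Qed.

(* From here on [gpoly] is only used through its coefficients; opacity keeps
   unification from unfolding the sums. *)
#[local] Opaque gpoly.

Lemma g_gpoly n m l : g n m l = gpoly n.+1%:Z (m + l)%N%:Z l%:Z.
Proof.
apply/mpolyP => mm; have [a [b [c ->]]] := mon3P mm.
rewrite mcoeff_gpoly mcoeff_weighted_sum.
have -> : (a + 2 * b + 3 * c == n + 1 + m + 2 * l)%N =
    ((a + 2 * b + 3 * c)%N%:Z == n.+1%:Z + (m + l)%N%:Z + l%:Z) by lia.
rewrite /gcoef (_ : _ - (m + l)%N%:Z = (a + b + c)%N%:Z - m%:Z - l%:Z) //; lia.
Qed.

Lemma wbar_gpoly r : wbar r = gpoly r%:Z 0 0.
Proof.
apply/mpolyP => mm; have [a [b [c ->]]] := mon3P mm.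
rewrite mcoeff_gpoly mcoeff_weighted_sum !addr0 eqz_nat.
by rewrite /gcoef !subr0 !binz_nat PoszM.
Qed.

Lemma mcoeffX_mul (m k : 'X_{1..3}) p :
  ('X_[m] * p)@_k = if (m <= k)%MM then p@_(k - m) else 0.
Proof.
case: ifP => [le_mk|/negP nle].
  by rewrite -{1}(submK le_mk) addmC mulrC mcoeffMX.
apply/eqP; rewrite mcoeff_eq0 mulrC (perm_mem (msuppMX _ _)).
by apply/mapP => -[j _ e]; apply: nle; rewrite e lem_addr.
Qed.

Definition w1 : Z2w := 'X_[mon3 1 0 0].
Definition w2 : Z2w := 'X_[mon3 0 1 0].
Definition w3 : Z2w := 'X_[mon3 0 0 1].

Lemma mcoeff_w1M p a b c :
  (w1 * p)@_(mon3 a b c) = if a is a'.+1 then p@_(mon3 a' b c) else 0.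
Proof.
rewrite mcoeffX_mul mon3_le !leq0n; case: a => [|a] //=.
by rewrite (_ : mon3 a.+1 b c = (mon3 a b c + mon3 1 0 0)%MM) ?addmK //
  mon3D !addn0 addn1.
Qed.

Lemma mcoeff_w2M p a b c :
  (w2 * p)@_(mon3 a b c) = if b is b'.+1 then p@_(mon3 a b' c) else 0.
Proof.
rewrite mcoeffX_mul mon3_le !leq0n; case: b => [|b] //=.
by rewrite (_ : mon3 a b.+1 c = (mon3 a b c + mon3 0 1 0)%MM) ?addmK //
  mon3D !addn0 addn1.
Qed.

Lemma mcoeff_w3M p a b c :
  (w3 * p)@_(mon3 a b c) = if c is c'.+1 then p@_(mon3 a b c') else 0.
Proof.
rewrite mcoeffX_mul mon3_le !leq0n; case: c => [|c] //=.
by rewrite (_ : mon3 a b c.+1 = (mon3 a b c + mon3 0 0 1)%MM) ?addmK //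
  mon3D !addn0 addn1.
Qed.

Lemma gpolyS_w1 d x y :
  gpoly (d + 1) x y = w1 * gpoly d x y + gpoly d (x + 1) y.
Proof.
apply/mpolyP => mm; have [a [b [c ->]]] := mon3P mm.
rewrite mcoeffD mcoeff_w1M !mcoeff_gpoly; case: a => [|a].
  rewrite add0r /gcoef !binz0 (_ : d + (x + 1) + y = d + 1 + x + y) //; lia.
rewrite mcoeff_gpoly.
rewrite (_ : _ == d + x + y = ((a.+1 + 2 * b + 3 * c)%N%:Z == d + 1 + x + y));
  last by lia.
rewrite (_ : d + (x + 1) + y = d + 1 + x + y); last by lia.
case: ifP => _; last by rewrite addr0.
rewrite -intrD; congr (_%:~R); rewrite /gcoef -mulrDl; congr (_ * _).
rewrite (_ : (a + b + c)%N%:Z - x = (a.+1 + b + c)%N%:Z - (x + 1)); last by lia.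
by rewrite [RHS]addrC -binz_pascal; congr binz; lia.
Qed.

Lemma gpolyS_w2 d x y :
  gpoly (d + 1) x y = w2 * gpoly d (x - 1) y + gpoly d x (y + 1).
Proof.
apply/mpolyP => mm; have [a [b [c ->]]] := mon3P mm.
rewrite mcoeffD mcoeff_w2M !mcoeff_gpoly; case: b => [|b].
  rewrite add0r /gcoef !binz0 (_ : d + x + (y + 1) = d + 1 + x + y) //; lia.
rewrite mcoeff_gpoly.
rewrite (_ : _ == d + (x - 1) + y =
  ((a + 2 * b.+1 + 3 * c)%N%:Z == d + 1 + x + y)); last by lia.
rewrite (_ : d + x + (y + 1) = d + 1 + x + y); last by lia.
case: ifP => _; last by rewrite addr0.
rewrite -intrD; congr (_%:~R); rewrite /gcoef.
rewrite (_ : (a + b + c)%N%:Z - (x - 1) = (a + b.+1 + c)%N%:Z - x); last by lia.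
rewrite -mulrDr; congr (_ * _).
rewrite (_ : (b + c)%N%:Z - y = (b.+1 + c)%N%:Z - (y + 1)); last by lia.
by rewrite [RHS]addrC -binz_pascal; congr binz; lia.
Qed.

(** The shift of [c]: here the terms of the left-hand side with [c = 0] have to
    vanish, which needs the conditions on the indices. *)
Lemma gpolyS_w3 d x y : 0 <= y <= x -> -3 < d ->
  gpoly (d + 1) (x + 1) (y + 1) = w3 * gpoly d x y.
Proof.
move=> /andP[y0 le_yx] d_gt.
apply/mpolyP => mm; have [a [b [c ->]]] := mon3P mm.
rewrite mcoeff_w3M !mcoeff_gpoly; case: c => [|c]; last first.
  rewrite mcoeff_gpoly.
  rewrite (_ : _ == d + x + y =
    ((a + 2 * b + 3 * c.+1)%N%:Z == d + 1 + (x + 1) + (y + 1))); last by lia.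
  rewrite /gcoef !addnS.
  by rewrite (_ : (a + b + c)%N.+1%:Z - (x + 1) = (a + b + c)%N%:Z - x)
    1?(_ : (b + c)%N.+1%:Z - (y + 1) = (b + c)%N%:Z - y) //; lia.
(* There is no term with c = 0: one of the two binomials has a top that is
   nonnegative and smaller than its bottom. *)
case: eqP => // eN; rewrite /gcoef !addn0 in eN *.
have [le_yb|lt_by] := lerP (y + 1) b%:Z.
  rewrite (_ : b%:Z - (y + 1) = (b - absz (y + 1)%R)%N%:Z); last by lia.
  by rewrite [X in _ * X]binz_small ?mulr0 //; lia.
rewrite (_ : (a + b)%N%:Z - (x + 1) = (a + b - absz (x + 1)%R)%N%:Z);
  last by lia.
by rewrite binz_small ?mul0r //; lia.
Qed.

(** * The polynomials just outside the standard range *)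

Lemma addZ2 p : p + p = 0.
Proof.
apply/mpolyP => m; rewrite mcoeffD mcoeff0.
by apply/eqP; case: (p@_m) => [[|[|]]].
Qed.

Lemma addKZ2 q p : q + (q + p) = p.
Proof. by rewrite addrA addZ2 add0r. Qed.

Lemma w1_gpoly d x y : w1 * gpoly d x y = gpoly (d + 1) x y + gpoly d (x + 1) y.
Proof. by rewrite gpolyS_w1 -addrA addZ2 addr0. Qed.

Lemma w2_gpoly d x y :
  w2 * gpoly d x y = gpoly (d + 1) (x + 1) y + gpoly d (x + 1) (y + 1).
Proof. by rewrite gpolyS_w2 addrK -addrA addZ2 addr0. Qed.

(** The polynomial [H e (e+1) 0], with [x] just outside the range [x <= e], and
    the standard polynomials [H e (e-j) (j+1)] in terms of which it is
    expressed. *)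
Definition overflow (e : nat) : Z2w := gpoly e%:Z (e%:Z + 1) 0.
Definition diagpoly (e j : nat) : Z2w := gpoly e%:Z (e%:Z - j%:Z) (j%:Z + 1).

Lemma overflow0 : overflow 0 = 0.
Proof.
apply/mpolyP => mm; have [a [b [c ->]]] := mon3P mm.
rewrite mcoeff_gpoly mcoeff0; case: eqP => // e.
have [-> [-> ->]] : a = 1%N /\ b = 0%N /\ c = 0%N by lia.
by rewrite /gcoef !addn0 addr0 add0r subrr (@binz_small 0 1) // binz0 mulr1.
Qed.

Lemma overflow1 : overflow 1 = gpoly 1 1 1.
Proof.
rewrite /overflow (@gpolyS_w2 0 2 0) -/(overflow 0) overflow0 mulr0 add0r.
rewrite (@gpolyS_w3 (-1) 1 0) // (@gpolyS_w3 0 0 0) //.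
by rewrite (@gpolyS_w1 (-1) 0 0) gpolyN1 mulr0 add0r.
Qed.

Lemma overflow_rec (e : nat) :
  overflow e.+2 =
    gpoly e.+2%:Z e.+2%:Z 1 + w2 * overflow e.+1 + w1 * (w3 * overflow e).
Proof.
rewrite {1}/overflow (_ : e.+2%:Z = e.+1%:Z + 1); last by lia.
rewrite gpolyS_w2 addrK (_ : e.+1%:Z = e%:Z + 1); last by lia.
rewrite (gpolyS_w3 (x := e%:Z + 1 + 1)); [|lia..].
have := gpolyS_w1 e%:Z (e%:Z + 1) 0.
rewrite -/(overflow e) => E.
have -> : gpoly e%:Z (e%:Z + 1 + 1) 0 =
    gpoly (e%:Z + 1) (e%:Z + 1) 0 + w1 * overflow e.
  by rewrite E [RHS]addrC addKZ2.
rewrite mulrDr -(gpolyS_w3 (y := 0)) ?add0r; [|lia..].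
rewrite (_ : overflow e.+1 = gpoly (e%:Z + 1) (e%:Z + 1 + 1) 0) ?add0r.
  by rewrite addrCA addrA; congr (_ + _); rewrite mulrCA.
by rewrite /overflow; congr gpoly; lia.
Qed.

(** Strong induction on [e] with [overflow_rec].  In [e + 3], expanding the
    products by [w2] and by [w1 * w3] produces, besides the right-hand side, the
    terms [K j]; modulo 2 these add up to [w3 ^+ 2] times the sum of both sides of
    the identity for [e], hence to zero.  The sum may be extended to any [M >= e],
    its terms with [j >= e] being zero. *)
Lemma overflowE (e M : nat) : (e <= M)%N ->
  overflow e = \sum_(j < M) diagpoly e j *+ 'C(e - j, j.+1).
Proof.
have big0 k N : (k <= N)%N -> forall F : nat -> Z2w,
    \sum_(j < N) F j *+ 'C(k - j, j.+1) = \sum_(j < k) F j *+ 'C(k - j, j.+1).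
  move=> le_kN F.
  rewrite -(subnKC le_kN) big_split_ord /= [X in _ + X]big1 ?addr0 //.
  by move=> i _; rewrite bin_small ?mulr0n //; lia.
elim/ltn_ind: e M => e IH M le_eM; case: e IH le_eM => [|[|[|e]]] IH le_eM.
- by rewrite overflow0 big0 // big_ord0.
- rewrite big0 // big_ord1 /= overflow1 /diagpoly binn mulr1n.
  by congr gpoly; lia.
- rewrite big0 // big_ord_recr big_ord1 /= bin1 bin_small //.
  rewrite mulr2n addZ2 mulr0n.
  rewrite overflow_rec overflow0 overflow1 !mulr0 addr0 w2_gpoly.
  rewrite (_ : gpoly 2 2 1 = gpoly (1 + 1) (1 + 1) 1) // addrA addZ2 add0r.
  rewrite (@gpolyS_w3 0 1 1) // (@gpolyS_w3 (-1) 0 0) //.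
  by rewrite gpolyN1 !mulr0 addr0.
case: M le_eM => // M le_eM.
rewrite overflow_rec (IH e.+2 _ M.+1) ?(IH e.+1 _ M.+1) //; [|lia..].
pose K (j : nat) : Z2w := gpoly e.+2%:Z (e.+3%:Z - j%:Z) (j%:Z + 2).
have w2F j : w2 * diagpoly e.+2 j = diagpoly e.+3 j + K j.
  rewrite /diagpoly w2_gpoly /K.
  by congr (_ + _); congr gpoly; lia.
have w13F j : (w1 * (w3 * diagpoly e.+1 j)) *+ 'C(e.+1 - j, j.+1) =
    (diagpoly e.+3 j.+1 + K j) *+ 'C(e.+1 - j, j.+1).
  have [le_j|gt_j] := leqP j.+1 (e.+1 - j);
    last by rewrite bin_small // !mulr0n.
  rewrite /diagpoly -gpolyS_w3 ?w1_gpoly /K; [|lia..].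
  by congr ((_ + _) *+ _); congr gpoly; lia.
have w33K j : K j *+ 'C(e.+1 - j, j) =
    w3 * (w3 * gpoly e%:Z (e%:Z + 1 - j%:Z) j%:Z) *+ 'C(e.+1 - j, j).
  have [le_j|gt_j] := leqP j (e.+1 - j); last by rewrite bin_small // !mulr0n.
  rewrite -!gpolyS_w3 /K; [|lia..].
  by congr (_ *+ _); congr gpoly; lia.
rewrite !mulr_sumr.
under eq_bigr do rewrite mulrnAr w2F mulrnDl.
under [X in _ + X = _]eq_bigr do rewrite !mulrnAr w13F mulrnDl.
rewrite !big_split /=.
set A := \sum_(i < M.+1) diagpoly _ i *+ _.
set B := \sum_(i < M.+1) K i *+ _.
set C := \sum_(i < M.+1) diagpoly _ i.+1 *+ _.
set D := \sum_(i < M.+1) K i *+ _.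
have BD : B + D = 0.
  rewrite -big_split /=.
  transitivity (\sum_(j < M.+1) K j *+ 'C(e.+1 - j, j)).
    apply: eq_bigr => j _.
    have [lt_j|ge_j] := leqP j e.+1;
      last by rewrite !bin_small ?mulr0n ?addr0 //; lia.
    by rewrite (subSn lt_j) binS mulrnDr addrAC addZ2 add0r.
  (* The term j = 0 is the left-hand side for e, the others its right-hand
     side. *)
  rewrite big_ord_recl /= w33K subn0 bin0 mulr1n.
  transitivity (w3 * (w3 * overflow e) +
      w3 * (w3 * \sum_(j < M) diagpoly e j *+ 'C(e - j, j.+1))).
    rewrite subr0 -/(overflow e); congr (_ + _).
    rewrite !mulr_sumr; apply: eq_bigr => j _.
    rewrite w33K !mulrnAr /bump /= subSS.
    rewrite /diagpoly (_ : e%:Z + 1 - j.+1%:Z = e%:Z - j%:Z); last by lia.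
    by rewrite (_ : j.+1%:Z = j%:Z + 1) //; lia.
  by rewrite -IH ?addZ2 //; lia.
rewrite -addrA addrACA BD addr0 /A /C.
rewrite [in X in _ + (X + _)]big_ord_recl big_ord_recr /=.
rewrite (@bin_small (e.+1 - M)) ?mulr0n ?addr0; last by lia.
rewrite [RHS]big_ord_recl /= !subn0 !bin1 -addrA -big_split /= addrA.
congr (_ + _); first by rewrite mulrS; congr (gpoly _ _ _ + _); lia.
apply: eq_bigr => j _; rewrite /bump /= add1n !subSS -mulrnDr.
have [lt_j|ge_j] := leqP j e.+1;
  last by rewrite !bin_small ?mulr0n ?addr0 //; lia.
by rewrite (subSn lt_j) binS.
Qed.

(** * The span of the standard polynomials of large degree *)

(** The polynomial of the family with leading monomial [m]: for
    [m = w1^a w2^b w3^c] it is [H (a+b+c) (b+c) c]. *)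
Definition stdpoly (m : 'X_{1..3}) : Z2w :=
  gpoly (mdeg m)%:Z (mdeg m - m ord0)%N%:Z (m ord_max)%:Z.

Lemma stdpoly_mon3 a b c :
  stdpoly (mon3 a b c) = gpoly (a + b + c)%N%:Z (b + c)%N%:Z c%:Z.
Proof.
rewrite /stdpoly mdeg_mon3 !multinomE !(tnth_nth 0%N) /=.
by rewrite -addnA addKn.
Qed.

(** [stdpoly m] is [m] plus terms of smaller total degree: when the degree of
    [k] is at least that of [m], both binomials have nonnegative tops unless one
    of them vanishes, and the weight then forces [k = m]. *)
Lemma mcoeff_stdpoly (m k : 'X_{1..3}) :
  (mdeg m <= mdeg k)%N -> (stdpoly m)@_k = (m == k)%:R.
Proof.
have [a [b [c ->]]] := mon3P m; have [a' [b' [c' ->]]] := mon3P k.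
rewrite !mdeg_mon3 stdpoly_mon3 mcoeff_gpoly mon3_eqE => le_deg.
have [[<- [<- <-]]|neq] : (a = a' /\ b = b' /\ c = c') \/
    ~~ [&& a == a', b == b' & c == c'] by lia.
  rewrite !eqxx /= ifT; last by lia.
  rewrite /gcoef (_ : _ - (b + c)%N%:Z = a%:Z); last by lia.
  rewrite (_ : _ - c%:Z = b%:Z); last by lia.
  by rewrite !binz_nat !binn mulr1.
rewrite (negPf neq); case: eqP => // eN; rewrite /gcoef.
rewrite (_ : _ - (b + c)%N%:Z = (a' + b' + c' - (b + c))%N%:Z); last by lia.
have [lt_bc|le_bc] := ltnP (b' + c') (b + c).
  by rewrite binz_small ?mul0r //; lia.
rewrite (_ : _ - c%:Z = (b' + c' - c)%N%:Z); last by lia.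
by rewrite [X in _ * X]binz_small ?mulr0 //; lia.
Qed.

(** The F_2-span of the standard polynomials with leading monomial of degree at
    least [d]: over F_2 a linear combination is the sum over a list. *)
Definition inspan (d : nat) p : Prop :=
  exists2 s : seq 'X_{1..3},
    all (fun m => d <= mdeg m)%N s & p = \sum_(m <- s) stdpoly m.

Lemma inspan_uniq (s : seq 'X_{1..3}) :
  exists2 t, uniq t & {subset t <= s} /\
    \sum_(m <- s) stdpoly m = \sum_(m <- t) stdpoly m.
Proof.
elim: s => [|m s [t ut [sub_ts eq_st]]]; first by exists [::].
rewrite big_cons eq_st; have [mt|mt] := boolP (m \in t).
  exists (rem m t); first exact: rem_uniq.
  split; first by move=> k /mem_rem /sub_ts; rewrite inE orbC => ->.
  by rewrite (big_rem m mt) /= addrA addZ2 add0r.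
exists (m :: t); first by rewrite /= mt.
split; last by rewrite big_cons.
by move=> k; rewrite !inE => /orP[->//|/sub_ts->]; rewrite orbT.
Qed.

(** In a sum of distinct standard polynomials, a leading monomial of largest
    degree does not cancel. *)
Lemma inspan_lead (d : nat) p : inspan d p -> p != 0 -> (d <= mdeg (mlead p))%N.
Proof.
move=> [s all_d ->]; have [t ut [sub_ts ->]] := inspan_uniq s => nz.
have [m0 m0t] : exists m, m \in t.
  case: t nz {ut sub_ts} => [|m t _]; first by rewrite big_nil eqxx.
  by exists m; rewrite mem_head.
pose P D := has (fun m => mdeg m == D) t.
have exP : exists D, P D by exists (mdeg m0); apply/hasP; exists m0.
have boundP D : P D -> (D <= \max_(m <- t) mdeg m)%N.
  by move=> /hasP[m mt /eqP<-]; apply: leq_bigmax_seq.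
case: (ex_maxnP exP boundP) => D /hasP[m mt /eqP degm] max_D.
apply: leq_trans (allP all_d _ (sub_ts _ mt)) _.
apply/lemc_mdeg/msupp_le_mlead; rewrite mcoeff_msupp raddf_sum /=.
rewrite (bigD1_seq m) //= mcoeff_stdpoly // eqxx.
rewrite big_seq_cond big1 ?addr0 ?oner_neq0 //.
move=> k /andP[kt nkm]; rewrite mcoeff_stdpoly ?(negPf nkm) // degm.
by apply: max_D; apply/hasP; exists k.
Qed.

Lemma inspan0 (d : nat) : inspan d 0.
Proof. by exists [::]; rewrite ?big_nil. Qed.

Lemma inspanD (d : nat) p q : inspan d p -> inspan d q -> inspan d (p + q).
Proof.
move=> [s all_s ->] [t all_t ->]; exists (s ++ t); last by rewrite big_cat.
by rewrite all_cat all_s.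
Qed.

Lemma inspan_sum (d : nat) (T : eqType) (s : seq T) (F : T -> Z2w) :
  (forall i, i \in s -> inspan d (F i)) -> inspan d (\sum_(i <- s) F i).
Proof.
move=> dF; rewrite big_seq.
by apply: big_ind => // [|p q]; [exact: inspan0|exact: inspanD].
Qed.

Lemma inspan_leq (d e : nat) p : (d <= e)%N -> inspan e p -> inspan d p.
Proof.
move=> le_de [s all_s ->]; exists s => //.
by apply: sub_all all_s => m; apply: leq_trans.
Qed.

Lemma PoszS (k : nat) : k.+1%:Z = k%:Z + 1.
Proof. by rewrite -addn1 PoszD. Qed.

Lemma inspan_gpoly (d i j : nat) : (j <= i <= d)%N ->
  inspan d (gpoly d%:Z i%:Z j%:Z).
Proof.
move=> /andP[le_ji le_id]; exists [:: mon3 (d - i) (i - j) j].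
  by rewrite /= mdeg_mon3 andbT; lia.
rewrite big_seq1 stdpoly_mon3 (_ : d - i + (i - j) + j = d)%N; last by lia.
by rewrite subnK.
Qed.

Lemma inspan_w3 (d : nat) p : inspan d p -> inspan d.+1 (w3 * p).
Proof.
move=> [s all_d ->]; exists [seq (mon3 0 0 1 + m)%MM | m <- s].
  rewrite all_map; apply: sub_all all_d => m /= le_d.
  by rewrite mdegD mdeg_mon3.
rewrite big_map mulr_sumr; apply: eq_bigr => m _.
have [a [b [c ->]]] := mon3P m; rewrite mon3D !stdpoly_mon3 !add0n.
rewrite -gpolyS_w3; [|lia..].
by congr gpoly; lia.
Qed.

Lemma inspan_overflow (e : nat) : inspan e (overflow e).
Proof.
rewrite (overflowE (leqnn e)); apply: inspan_sum => j _.
have [le_j|gt_j] := leqP j.+1 (e - j); last first.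
  by rewrite bin_small // mulr0n; apply: inspan0.
elim: 'C(_, _) => [|k IHk]; first by rewrite mulr0n; apply: inspan0.
rewrite mulrS; apply: inspanD => //.
rewrite /diagpoly (_ : e%:Z - j%:Z = (e - j)%N%:Z); last by lia.
rewrite (_ : j%:Z + 1 = j.+1%:Z); last by lia.
by apply: inspan_gpoly; lia.
Qed.

(** The third recurrence reduces [H d (d+1) y] to the case [y = 0], or to
    [H (-1) 0 0 = 0] when [y = d+1]. *)
Lemma inspan_border (d y : nat) : (y <= d.+1)%N ->
  inspan d (gpoly d%:Z d.+1%:Z y%:Z).
Proof.
elim: y d => [|y IHy] d le_y.
  rewrite PoszS; exact: inspan_overflow.
case: d le_y => [|d] le_y.
  have -> : y = 0%N by lia.
  by rewrite (@gpolyS_w3 (-1) 0 0) // gpolyN1 mulr0; apply: inspan0.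
rewrite (PoszS d) (PoszS d.+1) (PoszS y) gpolyS_w3; [|lia..].
exact/inspan_w3/IHy.
Qed.

Lemma inspan_gpolyS (d i j : nat) : (j <= i <= d.+1)%N ->
  inspan d (gpoly d%:Z i%:Z j%:Z).
Proof.
move=> /andP[le_ji]; rewrite leq_eqVlt => /orP[/eqP eq_i|lt_id].
  by rewrite eq_i; apply: inspan_border; lia.
by apply: inspan_gpoly; rewrite le_ji.
Qed.

Lemma inspan_stdpolyM (m : 'X_{1..3}) :
  [/\ inspan (mdeg m) (w1 * stdpoly m), inspan (mdeg m) (w2 * stdpoly m)
    & inspan (mdeg m) (w3 * stdpoly m)].
Proof.
have [a [b [c ->]]] := mon3P m; rewrite stdpoly_mon3 mdeg_mon3.
set d := (a + b + c)%N.
have up i j : (j <= i <= d.+1)%N -> inspan d (gpoly d.+1%:Z i%:Z j%:Z).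
  by move=> le_ij; apply/(inspan_leq (leqnSn d))/inspan_gpoly.
split; last first.
- apply: (inspan_leq (leqnSn d)); apply: inspan_w3.
  by apply: inspan_gpoly; rewrite /d; lia.
- rewrite w2_gpoly -!PoszS; apply: inspanD; first by apply: up; rewrite /d; lia.
  by apply: inspan_gpolyS; rewrite /d; lia.
rewrite w1_gpoly -!PoszS; apply: inspanD; first by apply: up; rewrite /d; lia.
by apply: inspan_gpolyS; rewrite /d; lia.
Qed.

Lemma inspan_wM (d : nat) p : inspan d p ->
  [/\ inspan d (w1 * p), inspan d (w2 * p) & inspan d (w3 * p)].
Proof.
move=> [s /allP all_d ->]; rewrite !mulr_sumr.
by split; apply: inspan_sum => m /all_d le_d; apply: (inspan_leq le_d);
  have [] := inspan_stdpolyM m.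
Qed.

Lemma inspanM (d : nat) p q : inspan d q -> inspan d (p * q).
Proof.
move=> dq; have monoM m : inspan d ('X_[m] * q).
  have [a [b [c ->]]] := mon3P m.
  elim: a => [|a IHa].
    elim: b => [|b IHb].
      elim: c => [|c IHc].
        suff -> : mon3 0 0 0 = 0%MM by rewrite mpolyX0 mul1r.
        by apply/eqP; rewrite -mdeg_eq0 mdeg_mon3.
      have [_ _] := inspan_wM IHc.
      by rewrite mulrA -mpolyXD mon3D.
    have [_ dw _] := inspan_wM IHb.
    by move: dw; rewrite mulrA -mpolyXD mon3D.
  have [dw _ _] := inspan_wM IHa.
  by move: dw; rewrite mulrA -mpolyXD mon3D.
elim/mpolyind: p => [|c m p _ _ IHp]; first by rewrite mul0r; apply: inspan0.
rewrite mulrDl; apply: inspanD => //; rewrite -scalerAl.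
have [->|c0] := eqVneq c 0; first by rewrite scale0r; apply: inspan0.
suff -> : c = 1 by rewrite scale1r.
by case: c c0 => [[|[|//]]] lt_c // _; apply: val_inj.
Qed.

Lemma inspan_ideal (d : nat) (S : Z2w -> Prop) p :
  (forall q, S q -> inspan d q) -> ideal_gen S p -> inspan d p.
Proof.
move=> dS [s [Ss ->]]; apply: inspan_sum => x xs.
by apply/inspanM/dS/Ss.
Qed.

(** * The reduced Groebner basis *)

Lemma mlead_stdpoly (m : 'X_{1..3}) : mlead (stdpoly m) = m.
Proof.
have cm : (stdpoly m)@_m = 1 by rewrite mcoeff_stdpoly ?eqxx.
have p0 : stdpoly m != 0.
  by apply: contra_eq_neq cm => ->; rewrite mcoeff0 eq_sym oner_neq0.
have le_m : (m <= mlead (stdpoly m))%O.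
  by apply: msupp_le_mlead; rewrite mcoeff_msupp cm oner_neq0.
have := mlead_supp p0; rewrite mcoeff_msupp mcoeff_stdpoly ?lemc_mdeg //.
by have [<- //|_] := eqVneq m (mlead (stdpoly m)); rewrite eqxx.
Qed.

Lemma mleadc_stdpoly (m : 'X_{1..3}) : mleadc (stdpoly m) = 1.
Proof. by rewrite mlead_stdpoly mcoeff_stdpoly ?eqxx. Qed.

Lemma stdpoly_neq0 (m : 'X_{1..3}) : stdpoly m != 0.
Proof. by rewrite -mleadc_eq0 mleadc_stdpoly oner_neq0. Qed.

(** [G n] consists of the standard polynomials of degree [n+1]. *)
Lemma G_stdpoly (n : nat) p :
  p \in G n <-> exists2 m, mdeg m = n.+1 & p = stdpoly m.
Proof.
split=> [/in_G[m [l [le_ml ->]]]|[m deg_m ->]].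
  exists (mon3 (n.+1 - (m + l)) m l); first by rewrite mdeg_mon3; lia.
  rewrite g_gpoly stdpoly_mon3.
  by rewrite (_ : n.+1 - (m + l) + m + l = n.+1)%N //; lia.
have [a [b [c Em]]] := mon3P m; apply/in_G; exists b, c.
move: deg_m; rewrite Em mdeg_mon3 => deg_m; split; first by lia.
by rewrite g_gpoly stdpoly_mon3 deg_m.
Qed.

Lemma lepm_exists (m : 'X_{1..3}) (d : nat) : (d <= mdeg m)%N ->
  exists2 k : 'X_{1..3}, mdeg k = d & (k <= m)%MM.
Proof.
have [a [b [c ->]]] := mon3P m; rewrite mdeg_mon3 => le_d.
pose a' := minn a d; pose b' := minn b (d - a').
exists (mon3 a' b' (d - a' - b')).
  by rewrite mdeg_mon3; lia.
by rewrite mon3_le; lia.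
Qed.

Lemma lepm_mdeg_eq (m k : 'X_{1..3}) :
  (m <= k)%MM -> mdeg m = mdeg k -> m = k.
Proof.
move=> le_mk; rewrite -{1}(submK le_mk) mdegD => e.
have /eqP : mdeg (k - m) = 0%N by lia.
by rewrite mdeg_eq0 => /eqP d0; rewrite -(submK le_mk) d0 add0m.
Qed.

Section Ideal.
Variable n : nat.
Let N : int := n.+1%:Z.

Lemma I3_wbar (i : nat) : (i < 3)%N -> I3 n (gpoly (N + i%:Z) 0 0).
Proof.
move=> lt_i; rewrite -PoszD -wbar_gpoly; apply: ideal_gen_mem.
by case: i lt_i => [|[|[|//]]] _; rewrite !inE ?addn0 ?addn1 ?addn2 eqxx ?orbT.
Qed.

(** Induction on the upper bound [x] of [i]: the polynomials with [i = x+1] are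
    obtained, by the first recurrence or for [j = x+1] by the second, from
    polynomials with first index [N + 1], which lie in the ideal by the induction
    hypothesis or because of a dual class. *)
Lemma I3_gpoly (i j : nat) : (j <= i)%N -> I3 n (gpoly N i%:Z j%:Z).
Proof.
move=> le_ji.
suff IH (x : nat) :
    forall i j : nat, (j <= i <= x)%N -> I3 n (gpoly N i%:Z j%:Z).
  by apply: (IH i); rewrite le_ji leqnn.
move=> {i j le_ji}; elim: x => [|x IHx] i j le_ijx.
  have [-> ->] : i = 0%N /\ j = 0%N by lia.
  by have := @I3_wbar 0 isT; rewrite addr0.
have [le_ix|eq_i] : (i <= x)%N \/ i = x.+1 by lia.
  by apply: IHx; lia.
have up (k : nat) : (k <= x)%N -> I3 n (gpoly (N + 1) x%:Z k%:Z).
  case: k => [|k] le_k.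
    case: x IHx {le_k le_ijx eq_i} => [|x] IHx; first exact: (@I3_wbar 1).
    rewrite gpolyS_w2 PoszS addrK add0r; apply: ideal_genD.
      by apply/ideal_genM/(IHx x 0%N); lia.
    by rewrite -PoszS; apply: (IHx _ 1%N); lia.
  case: x IHx le_k {le_ijx eq_i} => [//|x] IHx le_k.
  rewrite !PoszS gpolyS_w3; [|lia..].
  by apply/ideal_genM/IHx; lia.
rewrite eq_i; have [le_j|eq_j] : (j <= x)%N \/ j = x.+1 by lia.
  rewrite PoszS -[gpoly _ _ _](addKZ2 (w1 * gpoly N x%:Z j%:Z)).
  rewrite -gpolyS_w1; apply: ideal_genD; last exact: up.
  by apply/ideal_genM/IHx; lia.
rewrite eq_j -[gpoly _ _ _](addKZ2 (w2 * gpoly N x%:Z x%:Z)).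
apply: ideal_genD; first by apply/ideal_genM/IHx; lia.
rewrite w2_gpoly -!(PoszS x) -addrA addZ2 addr0.
case: x IHx up {le_ijx eq_i eq_j} => [|x] IHx up.
  have := @I3_wbar 2 isT; rewrite (_ : N + 2%:Z = N + 1 + 1); last by lia.
  rewrite gpolyS_w1 add0r => I2.
  rewrite -[gpoly _ _ _](addKZ2 (w1 * gpoly (N + 1) 0 0)).
  apply: ideal_genD I2; exact/ideal_genM/(up 0%N).
rewrite (PoszS x.+1) (PoszS x) gpolyS_w3; [|lia..].
by rewrite -(PoszS x); apply/ideal_genM/IHx; lia.
Qed.

Lemma I3_G p : p \in G n -> I3 n p.
Proof.
by move=> /in_G[m [l [_ ->]]]; rewrite g_gpoly; apply/I3_gpoly/leq_addl.
Qed.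

Lemma ideal_gen_G_I3 p : I3 n p -> ideal_gen (fun q => q \in G n) p.
Proof.
have genG (i j : nat) : (j <= i <= n.+1)%N ->
    ideal_gen (fun q => q \in G n) (gpoly N i%:Z j%:Z).
  move=> /andP[le_ji le_in]; apply/ideal_gen_mem/in_G; exists (i - j)%N, j.
  by rewrite g_gpoly subnK // addn1.
have g00 := genG 0%N 0%N isT; have g10 := genG 1%N 0%N isT.
have g11 := genG 1%N 1%N isT.
have gS0 : ideal_gen (fun q => q \in G n) (gpoly (N + 1) 0 0).
  by rewrite gpolyS_w1; apply: ideal_genD => //; apply: ideal_genM.
apply: ideal_gen_sub => q; rewrite !inE => /or3P[]/eqP->; rewrite wbar_gpoly //.
  by rewrite (PoszS n.+1).
rewrite (PoszS n.+2) (PoszS n.+1) -/N gpolyS_w1.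
apply: ideal_genD; first exact: ideal_genM.
rewrite gpolyS_w2 addrK; apply: ideal_genD; first exact: ideal_genM.
exact: g11.
Qed.

Lemma I3_inspan p : I3 n p -> inspan n.+1 p.
Proof.
move/ideal_gen_G_I3; apply: inspan_ideal => q /G_stdpoly[m deg_m ->].
by exists [:: m]; rewrite /= ?deg_m ?leqnn ?big_seq1.
Qed.

Lemma lead_ideal_G p :
  lead_ideal (fun q => q \in G n) p <-> lead_ideal (I3 n) p.
Proof.
split; first exact/lead_ideal_mono/I3_G.
apply: ideal_gen_sub => _ [q [Iq q0 ->]].
rewrite /lead_term -mul_mpolyC; apply: ideal_genM.
have [k deg_k le_k] := lepm_exists (inspan_lead (I3_inspan Iq) q0).
apply: (lead_idealX (p := stdpoly k)); last by rewrite mlead_stdpoly.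
  by apply/G_stdpoly; exists k.
exact: stdpoly_neq0.
Qed.

Lemma reduced_groebner_G : is_reduced_groebner_basis (I3 n) (G n).
Proof.
split; first split.
- move=> p; split; last exact: ideal_gen_G_I3.
  apply: ideal_gen_sub; exact: I3_G.
- exact: lead_ideal_G.
- by move=> p /G_stdpoly[m _ ->]; apply: mleadc_stdpoly.
move=> _ /G_stdpoly[m deg_m ->] k km /mem_lead_idealX[q].
rewrite in_fsetD1 => /andP[neq_q /G_stdpoly[j deg_j eq_q]] [_].
rewrite {q}eq_q mlead_stdpoly in neq_q *; move=> le_jk.
have le_deg : (mdeg m <= mdeg k)%N.
  by rewrite deg_m -deg_j -(submK le_jk) mdegD leq_addl.
move: km; rewrite mcoeff_msupp mcoeff_stdpoly //.
have [eq_mk _|] := eqVneq m k; last by rewrite eqxx.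
case/negP: neq_q; rewrite (lepm_mdeg_eq le_jk) -?eq_mk //.
by rewrite deg_j.
Qed.

End Ideal.
End Family.

Theorem theorem2p14 (n : nat) (hn : (3 <= n)%N) :
  unique (is_reduced_groebner_basis (I3 n)) (G n).
Proof.
split; first exact: reduced_groebner_G.
move=> A; apply: reduced_groebner_unique; exact: reduced_groebner_G.
Qed.
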